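(* Let $G$ be a finite permutation group on $\Omega$ with an abelian regular subgroup $A$ such that $A\neq G$ and $N_G(A)=A$. Then $|A|$ is not a prime power, and there exist subgroups $H,K$ of $A$ with $1<H\leq K<A$ such that the following holds: fix $\omega\in\Omega$ and identify $\Omega$ with $A$ via $a\leftrightarrow\omega^a$; then for every digraph $\Gamma$ on $\Omega$ with $G\leq\mathrm{Aut}(\Gamma)$, the corresponding Cayley digraph $\Gamma=\mathrm{Cay}(A,S)$ (for some $S\subseteq A$) is a generalized wreath digraph with respect to $(H,K,A)$.
   Context: All groups and digraphs are finite. A digraph is a pair $(V,R)$ with $V$ finite nonempty and $R\subseteq V\times V$ (loops allowed). For a group $G$ and $S\subseteq G$, $\mathrm{Cay}(G,S)$ has vertex set $G$, with $(g,h)$ an arc iff $gh^{-1}\in S$. If a regular abelian group $A$ acts as automorphisms of a digraph on $\Omega$, the identification $a\leftrightarrow\omega^a$ makes it a Cayley digraph $\mathrm{Cay}(A,S)$. Definition: for an abelian group $A$ and subgroups $1<H\leq K<A$, $\mathrm{Cay}(A,S)$ is a generalized wreath digraph with respect to $(H,K,A)$ if $S\setminus K$ is a union of $H$-cosets. *)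

(* Defs.v *)
From HB Require Import structures.
From mathcomp Require Import all_boot all_fingroup.
Set Implicit Arguments. Unset Strict Implicit. Unset Printing Implicit Defensive.
Local Open Scope group_scope.

Definition regular_perm (T : finType) (A : {set {perm T}}) : Prop :=
  [transitive A, on [set: T] | 'P] /\ forall x : T, 'C_A[x | 'P] = 1.

Definition preserves_digraph (T : finType) (G : {set {perm T}}) (R : rel T) : Prop :=
  forall g, g \in G -> forall x y : T, R (g x) (g y) = R x y.

(* Under the identification a <-> w^a (w^a = a w), the digraph R on T is
   Cay(A,S): (w^a, w^b) is an arc iff a b^-1 \in S. *)
Definition cayley_of (T : finType) (A : {set {perm T}}) (w : T) (R : rel T)
  (S : {set {perm T}}) : Prop :=
  S \subset A /\ forall a b, a \in A -> b \in A -> R (a w) (b w) = (a * b^-1 \in S).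

Definition gen_wreath (gT : finGroupType) (A H K S : {set gT}) : Prop :=
  [/\ [1] \proper H, H \subset K, K \proper A &
      exists X : {set gT}, S :\: K = \bigcup_(x in X) (x *: H)].

(* Main.v *)
(* Replacing G by a subgroup minimal above A, we may assume that A is maximal in
   G; then A meets its other conjugates exactly in Z := Z(G). Counting shows that
   the elements of G with no conjugate in A \ Z form the normal subgroup
   M = Z * G_w, for every point w, so each m in M acts at w as an element of Z;
   hence [M, M] fixes every point, and M is abelian. For a in A \ Z,
   W := [M, a] is an A-invariant subgroup meeting Z trivially, on which every
   b in A \ Z induces a surjective n |-> [n, b]. The pair is K := Z and
   H := {h in Z | m w = h w for some m in W}: surjectivity lets a suitable
   element of G_w move b w to (b h) w. Finally H is nontrivial of exponent
   dividing |G : A|, which is prime to |A| when A is a p-group, since A is then a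
   Sylow subgroup by self-normalization. *)
Require Import Defs.
From mathcomp Require Import all_boot all_fingroup.
From mathcomp Require Import all_solvable.
Set Implicit Arguments. Unset Strict Implicit.
Local Open Scope group_scope.

(** * Regular permutation groups and point stabilizers *)

Section RegularPerm.
Variables (T : finType) (A : {group {perm T}}).
Hypothesis regA : regular_perm A.

Lemma regular_fix1 a w : a \in A -> a w = w -> a = 1.
Proof.
move=> Aa fix_w; apply/set1P; rewrite -[[set 1]](proj2 regA w) inE Aa.
exact/astab1P.
Qed.

Lemma regular_inj a b w : a \in A -> b \in A -> a w = b w -> a = b.
Proof.
move=> Aa Ab eq_ab; apply/eqP; rewrite eq_mulgV1; apply/eqP.
by apply: (@regular_fix1 _ w); rewrite ?groupM ?groupV // permM eq_ab permK.
Qed.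

Lemma regular_transP w w' : exists2 a, a \in A & w' = a w.
Proof. by apply: (atransP2 (proj1 regA)); rewrite inE. Qed.

Lemma regular_inhabited : exists w : T, True.
Proof. by case/imsetP: (proj1 regA) => w _ _; exists w. Qed.

(** Compare the orbit-stabilizer formulas of [G] and [A], both transitive on [T]. *)
Lemma regular_card_stab (G : {group {perm T}}) w :
  A \subset G -> #|'C_G[w | 'P]| = #|G : A|.
Proof.
move=> sAG; have [trA fixA] := regA.
have trG : [transitive G, on [set: T] | 'P].
  apply/imsetP; exists w => //; apply/setP=> v; rewrite inE; apply/esym.
  have [a Aa ->] := regular_transP w v.
  by rewrite -[a w]/('P%act w a) mem_orbit ?(subsetP sAG).
have := card_orbit_stab 'P G w; have := card_orbit_stab 'P A w.
rewrite (atransP trG) ?(atransP trA) ?inE // fixA cards1 muln1 => -> /eqP.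
by rewrite -(Lagrange sAG) eqn_pmul2l ?cardG_gt0 // => /eqP.
Qed.

End RegularPerm.

(** Makes [m |-> [~ m, a]] an endomorphism of [M], so that its image is a subgroup and its
    injectivity a question about kernels. *)
Lemma commMg_in_abelian (gT : finGroupType) (M : {group gT}) a m n :
  abelian M -> a \in 'N(M) -> m \in M -> n \in M ->
  [~ m * n, a] = [~ m, a] * [~ n, a].
Proof.
move=> cMM Na Mm Mn; rewrite commMgJ; congr (_ * _).
rewrite conjgE (centsP cMM _ _ n) ?mulKg // commgEl.
by rewrite groupM ?groupV ?memJ_norm.
Qed.

Lemma comm_orbit (T : finType) (g h : {perm T}) w :
  commute g h -> g (h w) = h (g w).
Proof. by move=> cgh; rewrite -!permM cgh. Qed.

(** * A regular abelian subgroup that is maximal and self-normalizing *)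

Section SelfNormalizingMaximal.
Variables (T : finType) (G A : {group {perm T}}).
Hypotheses (cAA : abelian A) (regA : regular_perm A).
Hypotheses (maxA : maximal A G) (nAG : 'N_G(A) = A).

Notation Z := 'Z(G).

Let sAG : A \subset G.
Proof. by case/andP: (maxgroupp maxA). Qed.

Let sNA : 'N_G(A) \subset A.
Proof. by rewrite nAG. Qed.

Lemma center_sub_self_normalizing : Z \subset A.
Proof.
apply: subset_trans sNA; rewrite subsetI center_sub.
by rewrite subIset // (subset_trans (centS sAG)) ?orbT ?cent_sub.
Qed.
Let sZA := center_sub_self_normalizing.

Let ZC z g : z \in Z -> g \in G -> commute z g.
Proof. by case/centerP=> _ cz /cz. Qed.

Lemma center_proper_self_normalizing : Z \proper A.
Proof.
rewrite properEneq sZA andbT; apply/eqP=> defZ.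
case/andP: (maxgroupp maxA) => _ /negP[].
apply: subset_trans sNA; by rewrite subsetI subxx -[gval A]defZ gFnorm.
Qed.

(* An element of [A :&: A :^ g] is centralised by both [A] and [A :^ g], which
   generate [G] as soon as [g] does not normalise [A]. *)
Lemma conj_mem_self_normalizing a g :
  a \in A -> g \in G -> a ^ g \in A -> a \notin Z -> g \in A.
Proof.
move=> Aa Gg Ab; apply: contraR => nAg; set b := a ^ g in Ab.
have sAC : A \subset 'C_G[b] by rewrite subsetI sAG sub_cent1 (subsetP cAA).
have sAgC : A :^ g \subset 'C_G[b].
  rewrite subsetI sub_cent1 centJ mem_conjg conjgK (subsetP cAA) // andbT.
  by rewrite -(conjGid Gg) conjSg.
have [prC | ] := boolP ('C_G[b] \proper G).
  case/negP: nAg; apply: (subsetP sNA); rewrite inE Gg.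
  have [_ /(_ 'C_G[b]%G prC sAC) /= eqC] := maxgroupP maxA.
  by rewrite inE -{2}eqC.
rewrite properE subsetIl negbK subsetI subxx sub_cent1 /= => cGb.
suff Zb : b \in Z by rewrite -(memJ_norm a (subsetP (gFnorm _ _) g Gg)).
by rewrite inE (subsetP sAG).
Qed.

(* Elements with no conjugate in [A :\: Z]; modulo [Z] they form the Frobenius
   kernel. *)
Definition frob_kernel := <<G :\: class_support (A :\: Z) G>>%G.
Notation M := frob_kernel.

(* The inclusion holds because conjugates of nontrivial elements of [A] have no
   fixed point, and both sides have [#|Z| * #|G : A|] elements. *)
Lemma center_mul_stab w :
  Z * 'C_G[w | 'P] = G :\: class_support (A :\: Z) G.
Proof.
have tiAZ : normedTI (A :\: Z) G A.
  apply/normedTI_P; split.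
  - by rewrite setD_eq0; case/andP: center_proper_self_normalizing.
  - by rewrite subsetI sAG normsD ?normG // (subset_trans sAG) ?gFnorm.
  move=> g Gg /pred0Pn[x /= /andP[/setDP[Ax _]]].
  case/imsetP=> a /setDP[Aa nZa] def_x; rewrite def_x in Ax.
  exact: conj_mem_self_normalizing Ax nZa.
apply/eqP; rewrite eqEcard; apply/andP; split.
  apply/subsetP=> _ /mulsgP[z x Zz Cx ->]; have [Gx /astab1P fix_x] := setIP Cx.
  have Gz : z \in G by rewrite (subsetP (center_sub G)).
  rewrite inE groupM // andbT.
  apply/negP=> /imset2P[a g /setDP[Aa nZa] Gg def_zx].
  (* As [x] fixes [w], both [z] and [a] send [g^-1 w] to [g^-1 (z w)]; regularity identifies
     them. *)
  case/negP: nZa; suff -> : a = z by [].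
  apply: (@regular_inj _ _ regA _ _ (g^-1 w)) => //; first exact: (subsetP sZA).
  have -> : z (g^-1 w) = g^-1 (z w).
    by apply: comm_orbit; apply: ZC; rewrite ?groupV.
  have -> : z w = (z * x) w by rewrite (ZC Zz Gx) permM [x w]fix_x.
  by rewrite def_zx conjgE !permM permK.
have sKG : class_support (A :\: Z) G \subset G.
  by rewrite class_support_subG // (subset_trans (subsetDl _ _)).
rewrite cardsD (setIidPr sKG).
rewrite (card_support_normedTI tiAZ) TI_cardMg; last first.
  apply/trivgP/subsetP=> x /setIP[Zx /setIP[_ /astab1P fix_x]].
  by rewrite inE (@regular_fix1 _ _ regA x w) ?(subsetP sZA).
rewrite (regular_card_stab regA) // cardsD (setIidPr sZA) mulnBl.
by rewrite Lagrange // subKn // -(Lagrange sAG) leq_mul2r subset_leq_card ?orbT.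
Qed.

(** [Z] centralizes the stabilizer, so the product is already a group and generation adds
    nothing. *)
Lemma in_frob_kernel m w : (m \in M) = (m \in Z * 'C_G[w | 'P]).
Proof.
rewrite /= -(center_mul_stab w) -cent_joinEr ?genGid //.
by rewrite centsC (subset_trans (subsetIr G _)) ?centS ?subsetIl.
Qed.

Lemma frob_kernel_sub : M \subset G.
Proof. by rewrite gen_subG subsetDl. Qed.
Let sMG := frob_kernel_sub.

Lemma frob_kernel_norm : G \subset 'N(M).
Proof. by rewrite norms_gen // normsD ?normG ?class_support_norm. Qed.
Let nMG := frob_kernel_norm.

Lemma frob_kernel_orbit m w : m \in M -> exists2 z, z \in Z & m w = z w.
Proof.
rewrite (in_frob_kernel _ w).
case/mulsgP=> z x Zz /setIP[Gx /astab1P fix_x] ->; exists z => //.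
by rewrite (ZC Zz Gx) permM [x w]fix_x.
Qed.

Lemma frob_kernel_abelian : abelian M.
Proof.
apply/centsP=> m Mm n Mn; apply/permP=> w; rewrite !permM.
have [z Zz mw] := frob_kernel_orbit w Mm.
have [y Zy nw] := frob_kernel_orbit w Mn.
have [Gm Gn] := (subsetP sMG m Mm, subsetP sMG n Mn).
rewrite mw nw -(comm_orbit w (ZC Zz Gn)) -(comm_orbit w (ZC Zy Gm)) mw nw.
by apply: comm_orbit; apply: ZC; rewrite ?(subsetP (center_sub G)).
Qed.
Let cMM := frob_kernel_abelian.

Lemma frob_kernelI : M :&: A \subset Z.
Proof.
apply/subsetP=> m /setIP[Mm Am]; have [w _] := regular_inhabited regA.
have [z Zz mw] := frob_kernel_orbit w Mm.
by rewrite (regular_inj regA Am (subsetP sZA z Zz) mw).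
Qed.

(** If [[~ m, a]] is central, then [a ^ m] stays in [A], which forces [m] into [M :&: A]. *)
Lemma frob_kernel_commg_center a m :
  a \in A :\: Z -> m \in M -> [~ m, a] \in Z -> m \in Z.
Proof.
move=> /setDP[Aa nZa] Mm Zma; apply: (subsetP frob_kernelI).
rewrite inE Mm /=; have Gm := subsetP sMG m Mm.
have Zca : [~ a, m] \in Z by rewrite -invg_comm groupV.
apply: (@conj_mem_self_normalizing a) => //.
by rewrite conjg_mulR groupM // (subsetP sZA).
Qed.

(** * The complement [W] and the group [H] *)

Lemma exists_frob_complement :
  exists W : {group {perm T}},
    [/\ W \subset M, A \subset 'N(W), W :&: Z = 1, W :!=: 1
      & forall n, n \in W -> n ^+ #|G : A| = 1].
Proof.
have /subsetPn[a Aa nZa] : ~~ (A \subset Z).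
  by case/andP: center_proper_self_normalizing.
have AZa : a \in A :\: Z by rewrite inE nZa.
have Na : a \in 'N(M) by rewrite (subsetP nMG) ?(subsetP sAG).
have gW : group_set [set [~ m, a] | m in M].
  apply/group_setP; split; first by apply/imsetP; exists 1; rewrite ?comm1g.
  move=> _ _ /imsetP[m Mm ->] /imsetP[n Mn ->]; apply/imsetP.
  by exists (m * n); rewrite ?groupM ?(@commMg_in_abelian _ M).
have expC m k : m \in M -> [~ m, a] ^+ k = [~ m ^+ k, a].
  move=> Mm; elim: k => [|k IHk]; first by rewrite comm1g.
  by rewrite !expgS IHk (@commMg_in_abelian _ M) ?groupX.
exists (Group gW); split.
- apply/subsetP=> _ /imsetP[m Mm ->].
  by rewrite commgEl groupM ?groupV ?memJ_norm.
- apply/subsetP=> b Ab; rewrite inE.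
  apply/subsetP=> _ /imsetP[_ /imsetP[m Mm ->] ->].
  apply/imsetP; exists (m ^ b).
    by rewrite memJ_norm // (subsetP nMG) ?(subsetP sAG).
  by rewrite conjRg {2}/conjg (centsP cAA a Aa b Ab) mulKg.
- apply/trivgP/subsetP=> _ /setIP[/imsetP[m Mm ->] Zma].
  have Zm := frob_kernel_commg_center AZa Mm Zma.
  by rewrite inE; apply/commgP/ZC; rewrite ?(subsetP sAG).
(* A trivial [W] puts [M] inside [Z], so stabilizers are trivial and [#|G : A| = 1]. *)
- apply/eqP=> W1; have [w _] := regular_inhabited regA.
  have sMZ : M \subset Z.
    apply/subsetP=> m Mm; apply: (@frob_kernel_commg_center a) => //.
    suff: [~ m, a] \in [1 {perm T}] by move/set1P->; exact: group1.
    by rewrite -W1; apply/imsetP; exists m.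
  have C1 : 'C_G[w | 'P] = 1.
    apply/trivgP/subsetP=> x Cx; have [_ /astab1P fix_x] := setIP Cx.
    rewrite inE (@regular_fix1 _ _ regA x w) //.
    rewrite (subsetP sZA) // (subsetP sMZ) //.
    rewrite (in_frob_kernel _ w).
    by rewrite -[x]mul1g mem_mulg.
  have := regular_card_stab regA w sAG; rewrite C1 cards1 => /esym/eqP.
  rewrite indexg_eq1; apply/negP.
  by case/andP: (maxgroupp maxA).
move=> _ /imsetP[m Mm ->]; rewrite expC //.
have [w _] := regular_inhabited regA; move: Mm.
(* Write [m = z * x] with [x] fixing [w]: the stabilizer has order [#|G : A|], so this power of [m]
   is central. *)
rewrite (in_frob_kernel _ w).
case/mulsgP=> z x Zz Cx ->; have Gx := subsetP (subsetIl _ _) x Cx.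
rewrite expgMn; last exact: ZC.
rewrite -(regular_card_stab regA w sAG) (expg_cardG Cx) mulg1.
by apply/eqP/commgP/ZC; rewrite ?groupX ?(subsetP sAG).
Qed.

Lemma exists_wreath_group :
  exists H : {group {perm T}},
    [/\ [1] \proper H, H \subset Z, forall h, h \in H -> h ^+ #|G : A| = 1
      & forall w a h, a \in A :\: Z -> h \in H ->
          exists x, [/\ x \in G, x w = w & x (a w) = (a * h) w]].
Proof.
have [W [sWM nWA tiWZ ntW expW]] := exists_frob_complement.
have sWG := subset_trans sWM sMG.
have [w0 _] := regular_inhabited regA.
pose H := [set h in Z | [exists m in W, m w0 == h w0]].
have gH : group_set H.
  apply/group_setP; split.
    by rewrite inE group1; apply/existsP; exists 1; rewrite group1 eqxx.
  move=> h k /setIdP[Zh /'exists_in_eqP[m Wm mh]].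
  case/setIdP=> Zk /'exists_in_eqP[n Wn nk].
  apply/setIdP; split; first exact: groupM.
  apply/'exists_in_eqP; exists (m * n); rewrite ?groupM // !permM mh.
  rewrite -(comm_orbit w0 (ZC Zh (subsetP sWG n Wn))) nk; apply: comm_orbit.
  by apply: ZC; rewrite ?(subsetP (center_sub G)).
(* Conjugating [m] by an element of [A] that takes [w0] to [w] frees [H] from the base point. *)
have HP w h : h \in H -> h \in Z /\ exists2 m, m \in W & m w = h w.
  case/setIdP=> Zh /'exists_in_eqP[m Wm mh]; split=> //.
  have [b Ab ->] := regular_transP regA w0 w.
  have Gb := subsetP sAG b Ab.
  exists (m ^ b); first by rewrite memJ_norm ?(subsetP nWA).
  by rewrite -permM -conjgC permM mh (@comm_orbit T h) //; apply: ZC.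
(* Injective on [W] because [W] meets [Z] trivially, hence onto by finiteness. *)
have commW a v : a \in A :\: Z -> v \in W -> exists2 n, n \in W & [~ n, a] = v.
  move=> AZa Wv; have [Aa nZa] := setDP AZa.
  have Na : a \in 'N(M) by rewrite (subsetP nMG) ?(subsetP sAG).
  have sub : [set [~ n, a] | n in W] \subset W.
    apply/subsetP=> _ /imsetP[n Wn ->].
    by rewrite commgEl groupM ?groupV // memJ_norm ?(subsetP nWA).
  have inj : {in W &, injective (fun n => [~ n, a])}.
    move=> m n Wm Wn /= eq_mn; apply/eqP; rewrite eq_mulgV1 -in_set1.
    rewrite -[[set 1]]tiWZ inE groupM ?groupV //=.
    apply: (@frob_kernel_commg_center a) => //.
      by rewrite groupM ?groupV ?(subsetP sWM).
    rewrite (@commMg_in_abelian _ M) ?groupV ?(subsetP sWM) // eq_mn.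
    rewrite -(@commMg_in_abelian _ M) ?groupV ?(subsetP sWM) //.
    by rewrite mulgV comm1g group1.
  have /eqP/setP/(_ v) : [set [~ n, a] | n in W] == (W : {set _}).
    by rewrite eqEcard sub (card_in_imset inj) leqnn.
  by rewrite Wv => /imsetP[n Wn ->]; exists n.
exists (Group gH); split.
(* If [n] acts at [b w0] as [z], then [n ^ b^-1] acts at [w0] as [z], so [z] lies in [H]; with [H]
   trivial, [n] fixes every point. *)
- rewrite proper1G; apply: contra ntW => /eqP H1; apply/eqP/trivgP.
  apply/subsetP=> n Wn; rewrite inE; apply/eqP/permP=> w; rewrite perm1.
  have [b Ab ->] := regular_transP regA w0 w; have Gb := subsetP sAG b Ab.
  have [z Zz nz] := frob_kernel_orbit (b w0) (subsetP sWM n Wn).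
  suff Hz : z \in H.
    by move: Hz nz; rewrite (H1 : H = 1) => /set1P->; rewrite perm1.
  apply/setIdP; split=> //; apply/'exists_in_eqP; exists (n ^ b^-1).
    by rewrite memJ_norm // groupV (subsetP nWA).
  by rewrite conjgE invgK !permM nz (comm_orbit w0 (ZC Zz Gb)) permK.
- by apply/subsetP=> h /HP-/(_ w0)[].
- move=> h Hh; have [Zh [m Wm mh]] := HP w0 h Hh.
  apply: (@regular_fix1 _ _ regA _ w0); first by rewrite groupX ?(subsetP sZA).
  have chm : commute h m by apply: ZC; rewrite ?(subsetP sWG).
  suff -> k : (h ^+ k) w0 = (m ^+ k) w0 by rewrite expW // perm1.
  elim: k => [|k IHk]; first by [].
  rewrite expgS permM -mh expgS.
  rewrite (@comm_orbit T) ?IHk -?permM -?expgSr -?expgS //.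
  exact/commute_sym/commuteX.
move=> w a h AZa Hh; have [Aa nZa] := setDP AZa.
have [Zh [v Wv vh]] := HP w h Hh.
(* [[~ n, a^-1] = v] means [a * n = n * v * a]; dividing [n] by the [z] that agrees with it at [w]
   makes it fix [w]. *)
have [|n Wn def_v] := commW a^-1 v _ Wv; first by apply/setDP; rewrite !groupV.
have [z Zz nz] := frob_kernel_orbit w (subsetP sWM n Wn).
exists (n * z^-1); split.
- have Gz := subsetP (center_sub G) z Zz.
  have Gn := subsetP sWG n Wn; by rewrite groupM ?groupV.
- by rewrite permM nz permK.
have def_an : a * n = n * v * a.
  by rewrite -def_v commgEl conjgE invgK !mulgA mulgV mul1g mulgKV.
have [Ga Gv] := (subsetP sAG a Aa, subsetP sWG v Wv).
have -> : (n * z^-1) (a w) = z^-1 ((a * n) w) by rewrite !permM.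
rewrite def_an !permM nz -(comm_orbit w (ZC Zz Gv)) vh.
by rewrite -(comm_orbit _ (ZC Zz Ga)) permK (comm_orbit _ (ZC Zh Ga)).
Qed.

(** * Exclusion of prime powers *)

Lemma self_normalizing_not_pgroup (p : nat) : ~~ p.-group A.
Proof.
apply/negP=> pA.
have [P sylP sAP] := Sylow_superset sAG pA.
have [sPG pP _] := and3P sylP.
have defA : A :=: P.
  apply: esym; apply: (nilpotent_sub_norm (pgroup_nil pP) sAP).
  exact: subset_trans (setSI _ sPG) sNA.
have [H [/andP[_ ntH] sHZ expH _]] := exists_wreath_group.
case/negP: ntH; apply/subsetP=> h Hh; rewrite inE -order_eq1 -dvdn1.
have co : coprime #|A| #|G : A|.
  by rewrite (pnat_coprime pA) // defA; case/and3P: sylP.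
have Ah : h \in A by rewrite (subsetP sZA) // (subsetP sHZ).
by rewrite -(eqP co) dvdn_gcd order_dvdG //= order_dvdn (expH h Hh).
Qed.

End SelfNormalizingMaximal.

(** * Reduction to a minimal overgroup of [A], and digraphs *)

Theorem theorem4p2 (T : finType) (G A : {group {perm T}}) :
  A \subset G -> abelian A -> regular_perm A -> A != G -> 'N_G(A) = A ->
  (forall p k : nat, prime p -> #|A| <> (p ^ k)%N) /\
  exists H K : {group {perm T}},
    [/\ [1] \proper H, H \subset K, K \proper A &
        forall (w : T) (R : rel T), preserves_digraph G R ->
          exists S : {set {perm T}}, cayley_of A w R S /\ gen_wreath A H K S].
Proof.
move=> sAG cAA regA neAG nAG.
have prAG : A \proper G by rewrite properEneq; apply/andP; split.
have [B minB sBG] := mingroup_exists (gP := fun B => A \proper B) prAG.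
have [prAB minBP] := mingroupP minB.
have maxA : maximal A B.
  apply/maxgroupP; split=> // K prKB sAK; apply/eqP; apply: wlog_neg => neKA.
  have prAK : A \proper K by rewrite properEneq eq_sym neKA.
  have defK := minBP K prAK (proper_sub prKB).
  by rewrite defK properxx in prKB.
have nAB : 'N_B(A) = A.
  apply/eqP; rewrite eqEsubset subsetI normG (proper_sub prAB) !andbT.
  by rewrite -{2}nAG setSI.
have [H [ntH sHZ _ wrH]] := exists_wreath_group cAA regA maxA nAB.
have prZA := center_proper_self_normalizing maxA nAB.
split=> [p k pr_p cardA|].
  have := self_normalizing_not_pgroup cAA regA maxA nAB p.
  by rewrite /pgroup cardA pnatX pnat_id.
exists H, 'Z(B)%G; split=> // w R autR.
(* [S] records the arcs into [w]; applying [b^-1] brings an arc ending at [b w] to one ending at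
   [w]. *)
pose S := [set a in A | R (a w) w]; exists S; split.
  split=> [|a b Aa Ab]; first by apply/subsetP=> a /setIdP[].
  rewrite inE groupM ?groupV //= permM.
  have Gb' : b^-1 \in G by rewrite groupV (subsetP sAG).
  by rewrite -(autR _ Gb') permK.
(* With this set as its own index set, only closure under right multiplication by [H] remains. *)
split=> //; exists (S :\: 'Z(B)); apply/setP=> a; apply/idP/bigcupP=> [Sa|].
  by exists a; rewrite // lcoset_refl.
case=> b /setDP[/setIdP[Ab Rb] nZb] /lcosetP[h Hh ->].
have Zh := subsetP sHZ h Hh; have Ah := subsetP (proper_sub prZA) h Zh.
apply/setDP; rewrite groupMr //; split=> //.
apply/setIdP; split; first exact: groupM.
(* [x] fixes [w] and moves [b w] to [(b * h) w], so it carries the known arc to the required one. *)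
have [|//|x [Bx xw <-]] := wrH w b h; first exact/setDP.
by rewrite -[w in R _ w]xw autR ?(subsetP sBG).
Qed.
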